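(* Let $G$ be a subcubic loopless multigraph (that is, a loopless multigraph with maximum degree at most $3$). Then $ch_i(G)\le 6$.
   Context: Multigraphs are finite and loopless and may have multiple edges. An incidence of a multigraph $G$ is a pair $(u,e)$ where $u$ is a vertex of $G$ and $e$ is an edge of $G$ having $u$ as an endpoint; $I(G)$ denotes the set of all incidences of $G$. Two distinct incidences $(u,e)$ and $(v,f)$ are adjacent if one of the following holds: (i) $u=v$; (ii) $e=f$; (iii) $e$ or $f$ is an edge with endpoints $u$ and $v$. An incidence coloring of $G$ is a function $\varphi$ from $I(G)$ to a set of colors such that $\varphi(u,e)\neq\varphi(v,f)$ for any two adjacent incidences $(u,e)$, $(v,f)$ of $G$. An incidence list assignment $L$ of $G$ assigns to each $(v,e)\in I(G)$ a nonempty set $L(v,e)$ of colors; it is an incidence $k$-list assignment if $|L(v,e)|=k$ for every $(v,e)\in I(G)$. $G$ is incidence $L$-choosable if there is an incidence coloring $\varphi$ of $G$ with $\varphi(v,e)\in L(v,e)$ for every incidence $(v,e)$. $G$ is incidence $k$-choosable if it is incidence $L$-choosable for every incidence $k$-list assignment $L$. The incidence choice number $ch_i(G)$ is the smallest integer $k$ such that $G$ is incidence $k$-choosable. *)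

(* Defs.v *)
From HB Require Import structures.
From mathcomp Require Import all_boot finmap.
From mathcomp Require Import boolp.

Set Implicit Arguments.
Unset Strict Implicit.
Unset Printing Implicit Defensive.

(* Parallel edges are distinct elements of [edge] with the same set of ends;
   looplessness is the requirement that an edge has exactly two ends. *)
Record multigraph := Multigraph {
  vertex : finType;
  edge : finType;
  ends : edge -> {set vertex};
  card_ends : forall e : edge, #|ends e| = 2
}.

Definition degree (G : multigraph) (v : vertex G) : nat :=
  #|[set e : edge G | v \in ends e]|.

Definition max_degree (G : multigraph) : nat :=
  \max_(v : vertex G) degree v.

Definition subcubic (G : multigraph) : Prop := max_degree G <= 3.

Definition incidence (G : multigraph) : finType :=
  {i : vertex G * edge G | i.1 \in ends i.2}.

Definition inc_vertex (G : multigraph) (i : incidence G) : vertex G :=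
  (val i).1.

Definition inc_edge (G : multigraph) (i : incidence G) : edge G :=
  (val i).2.

Definition inc_adj (G : multigraph) (i j : incidence G) : bool :=
  let u := inc_vertex i in let e := inc_edge i in
  let v := inc_vertex j in let f := inc_edge j in
  (i != j) && [|| u == v, e == f, ends e == [set u; v] | ends f == [set u; v]].

Definition incidence_coloring (G : multigraph) (C : Type)
    (phi : incidence G -> C) : Prop :=
  forall i j : incidence G, inc_adj i j -> phi i <> phi j.

Definition list_assignment (G : multigraph) (C : choiceType)
    (L : incidence G -> {fset C}) : Prop :=
  forall i : incidence G, L i != fset0.

Definition k_list_assignment (G : multigraph) (C : choiceType) (k : nat)
    (L : incidence G -> {fset C}) : Prop :=
  list_assignment L /\ forall i : incidence G, #|` L i| = k.

Definition L_choosable (G : multigraph) (C : choiceType)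
    (L : incidence G -> {fset C}) : Prop :=
  exists phi : incidence G -> C,
    incidence_coloring phi /\ forall i : incidence G, phi i \in L i.

Definition incidence_choosable (G : multigraph) (k : nat) : Prop :=
  forall (C : choiceType) (L : incidence G -> {fset C}),
    k_list_assignment k L -> L_choosable L.

(* Lists are nonempty, so there is no 0-list assignment of a graph with an
   edge and [incidence_choosable G 0] holds vacuously: the choice number
   ranges over positive integers. *)
Definition choosable_pred (G : multigraph) : pred nat :=
  fun k => (0 < k) && `[< incidence_choosable G k >].

Lemma ex_choosable (G : multigraph) : exists k, choosable_pred G k.
Proof.
exists #|incidence G|.+1; apply/andP; split => //; apply/asboolP => C L [L0 Lk].
have pick i : exists c, c \in L i by apply/fset0Pn; exact: L0.
suff [phi [phiL phi_inj]] : exists phi : incidence G -> C,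
    (forall i, phi i \in L i) /\ {in enum (incidence G) &, injective phi}.
  exists phi; split => // i j /andP[/eqP ij _] /phi_inj.
  by rewrite !mem_enum => /(_ isT isT).
have : size (enum (incidence G)) <= #|incidence G| by rewrite -cardE.
elim: (enum _) => [|i s IHs] szs.
  by exists (fun i => xchoose (pick i)); split => // i; exact: xchooseP.
have [phi [phiL phi_inj]] := IHs (ltnW szs).
have [si|si] := boolP (i \in s).
  exists phi; split => // a b; rewrite !inE => ha hb; apply: phi_inj.
    by case/orP: ha => [/eqP ->|].
  by case/orP: hb => [/eqP ->|].
have [c cL cs] : exists2 c, c \in L i & c \notin map phi s.
  have : ~~ all (mem (map phi s)) (L i).
    apply/negP => /allP sub.
    have := uniq_leq_size (fset_uniq (L i)) sub.
    rewrite size_map -[size (L i)]/(#|` L i|) Lk ltnNge => /negP; apply.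
    exact: ltnW.
  by case/allPn => c cL cs; exists c.
exists (fun a => if a == i then c else phi a); split => [a|a b].
  by case: eqP => [->|].
have out x : x \in s -> c <> phi x.
  by move=> xs cx; case/negP: cs; rewrite cx map_f.
rewrite !inE; case: (eqVneq a i) => [->|_]; case: (eqVneq b i) => [->|_] //=.
- by move=> _ /out.
- by move=> /out h _ /esym.
- exact: phi_inj.
Qed.

Definition ch_i (G : multigraph) : nat := ex_minn (ex_choosable G).

(* Main.v *)
(** Read an incidence [(u, e)] with [e = uv] as an arc from [u] to [v]: two arcs
    conflict when they have the same tail or the head of one is the tail of the
    other, so in a cubic graph every arc has at most 7 conflicts.

    Call a vertex set [T] absorbable if every list coloring of the arcs leaving
    a set [S] disjoint from [T] yields one of the arcs leaving [S] and [T].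
    Coloring greedily, [T] can be enlarged by any vertex that has degree at most
    2 or an arc into [T].  When neither is available, the rest of the graph is
    3-regular and not joined to [T]; it then contains a pair of parallel edges, a
    triangle, a 4-cycle, or the tree obtained from the claw by subdividing one
    edge, each induced.  The vertex set of each of these is absorbable by the
    Alon-Tarsi theorem: with the arcs entering from outside already colored, the
    lists that remain exceed the outdegrees of a degree sequence whose signed
    number of orientations is nonzero. *)

Require Import Defs.
From mathcomp Require Import all_boot all_order all_algebra finmap zify boolp.

Set Implicit Arguments.
Unset Strict Implicit.
Unset Printing Implicit Defensive.

Import Order.TTheory GRing.Theory Num.Theory.

(** ** The Alon-Tarsi theorem *)

Definition edge_count (E : seq (nat * nat)) (i : nat) : nat :=
  count (fun p => (p.1 == i) || (p.2 == i)) E.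

(** Signed number of orientations of [E] with outdegree sequence [d]; the initial
    test only prunes branches that contribute 0. *)
Fixpoint orient (E : seq (nat * nat)) (d : seq nat) : int :=
  if has (fun i => edge_count E i < nth 0 d i) (iota 0 (size d)) then 0%R else
  if E is (a, b) :: E' then
    let giving i :=
      if nth 0 d i is k.+1 then orient E' (set_nth 0 d i k) else 0%R in
    (giving a - giving b)%R
  else 1%R.

(** The functional is obtained by inverting a Vandermonde matrix. *)
Lemma moment_functional (N k : nat) (S : {set 'I_N}) :
  k < #|S| ->
  exists mu : 'I_N -> rat, (forall c, mu c != 0%R -> c \in S) /\
    forall j, j <= k -> (\sum_c mu c * c%:R ^+ j = (j == k)%:R)%R.
Proof.
move=> ltkS; pose h (j : 'I_k.+1) : 'I_N := enum_val (widen_ord ltkS j).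
have h_inj : injective h.
  by move=> i j /enum_val_inj/(congr1 val)/= /val_inj.
pose a : 'rV[rat]_k.+1 := (\row_j (h j)%:R)%R.
have Vunit : Vandermonde k.+1 a \in unitmx.
  rewrite unitmxE det_Vandermonde unitfE; apply/prodf_neq0 => i _.
  apply/prodf_neq0 => j ltij; rewrite !mxE subr_eq0 eqr_nat.
  by apply: contraTneq ltij => /val_inj/h_inj ->; rewrite ltnn.
pose m : 'cV[rat]_k.+1 := (invmx (Vandermonde k.+1 a) *m delta_mx ord_max 0)%R.
exists (fun c => \sum_(j | h j == c) m j 0)%R; split.
  move=> c; apply: contraNT => Sc; rewrite big1 // => j /eqP hj.
  by case/negP: Sc; rewrite -hj enum_valP.
move=> j lejk; have := mulKVmx Vunit (delta_mx ord_max 0 : 'cV[rat]_k.+1)%R.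
rewrite -/m => /matrixP/(_ (Ordinal (lejk : j < k.+1)) 0%R).
rewrite !mxE -val_eqE /= eqxx andbT => <-.
transitivity (\sum_c \sum_(i | h i == c) m i 0 * (h i)%:R ^+ j)%R.
  apply: eq_bigr => c _; rewrite mulr_suml.
  by apply: eq_bigr => i /eqP ->.
symmetry; rewrite (partition_big h predT) //=; apply: eq_bigr => c _.
by apply: eq_bigr => i _; rewrite !mxE mulrC.
Qed.

(** * Moment functionals applied to the graph polynomial *)

Section Weighted.
Local Open Scope ring_scope.
Variables (n N : nat) (d : nat -> nat) (mu : 'I_n.+1 -> 'I_N -> rat).
Hypothesis mu_moment : forall (i : 'I_n.+1) k, (k <= d i)%N ->
  \sum_c mu i c * c%:R ^+ k = (k == d i)%:R.

(** The product of the functionals [mu i], applied to the monomial with exponents [e] times the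
    graph polynomial of [E]; [e] records the factors already expanded. *)
Definition weighted_sum (E : seq (nat * nat)) (e : nat -> nat) : rat :=
  \sum_(phi : {ffun 'I_n.+1 -> 'I_N})
    (\prod_i (mu i (phi i) * (phi i)%:R ^+ e i)) *
    \prod_(p <- E) ((phi (inord p.1))%:R - (phi (inord p.2))%:R).

Lemma weighted_sum_nil e :
  weighted_sum [::] e = \prod_(i < n.+1) \sum_c mu i c * c%:R ^+ e i.
Proof.
rewrite bigA_distr_bigA; apply: eq_bigr => phi _.
by rewrite big_nil mulr1.
Qed.

(** The first factor is split into its two terms; the end that contributes its variable is the tail
    of the edge in the orientation. *)
Lemma weighted_sum_cons a b E e : (a < n.+1)%N -> (b < n.+1)%N ->
  weighted_sum ((a, b) :: E) e =
  weighted_sum E (fun i => (i == a) + e i)%N -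
  weighted_sum E (fun i => (i == b) + e i)%N.
Proof.
move=> ltan ltbn; rewrite -sumrB; apply: eq_bigr => phi _.
have raise x : (x < n.+1)%N ->
  \prod_i (mu i (phi i) * (phi i)%:R ^+ ((i == x :> nat) + e i)) =
  (phi (inord x))%:R * \prod_i (mu i (phi i) * (phi i)%:R ^+ e i).
  move=> ltxn; rewrite (bigD1 (inord x)) //= [in RHS](bigD1 (inord x)) //=.
  rewrite inordK // eqxx add1n exprS !mulrA; congr (_ * _).
    by rewrite [mu _ _ * _]mulrC.
  apply: eq_bigr => i /negPf nix.
  by rewrite -[in (i == x :> nat)](inordK ltxn) val_eqE nix.
by rewrite big_cons !raise // mulrCA -!mulrA -mulrBl.
Qed.

Lemma sum_raise (e : nat -> nat) x : (x < n.+1)%N ->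
  (\sum_(j < n.+1) ((j == x :> nat) + e j) = (\sum_(j < n.+1) e j).+1)%N.
Proof.
move=> ltxn; rewrite big_split /= (bigD1 (Ordinal ltxn)) //= eqxx big1 //.
by move=> j; rewrite -val_eqE => /negPf ->.
Qed.

(** No monomial of the expansion has exponents exactly [d]. As all have the total degree of [d],
    each has an exponent below its target, where the moment is 0. *)
Lemma weighted_sum_eq0 E (e : nat -> nat) :
  all (fun p => (p.1 < n.+1) && (p.2 < n.+1))%N E ->
  (size E + \sum_(i < n.+1) e i = \sum_(i < n.+1) d i)%N ->
  (exists i : 'I_n.+1, (d i < e i) || (e i + edge_count E i < d i))%N ->
  weighted_sum E e = 0.
Proof.
elim: E e => [|[a b] E IHE] e /=.
  move=> _; rewrite add0n weighted_sum_nil => sum_e [i ei].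
  (* Moments beyond [d i] are not controlled, but an exponent above its target at [i] forces one
     below its target at some [j]. *)
  have [j ltj] : exists j : 'I_n.+1, (e j < d j)%N.
    move: ei; rewrite addn0 => /orP[lti|]; last by exists i.
    apply/existsP; apply: contraPT sum_e => /existsPn/= geq_e; apply/eqP.
    rewrite eq_sym ltn_eqF // (bigD1 i) //= [ltnRHS](bigD1 i) //= -addSn.
    by rewrite leq_add // leq_sum // => k _; rewrite leqNgt geq_e.
  by rewrite (bigD1 j) //= mu_moment ?(ltnW ltj) // ltn_eqF ?mul0r.
case/andP=> /andP[ltan ltbn] bndE; rewrite addSn => sum_e [i ei].
rewrite weighted_sum_cons // !IHE ?subrr ?sum_raise ?addnS //; exists i.
  by move: ei; rewrite /edge_count /=; lia.
by move: ei; rewrite /edge_count /=; lia.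
Qed.

(** Here [e] is the outdegree supplied so far and [r] the one still owed. Expanding the product
    follows the recursion of [orient], whose pruned branches vanish by [weighted_sum_eq0]. *)
Lemma weighted_sum_orient E r (e : nat -> nat) :
  all (fun p => (p.1 < n.+1) && (p.2 < n.+1))%N E ->
  (size r <= n.+1)%N ->
  (forall i, i < n.+1 -> e i + nth 0%N r i = d i)%N ->
  (size E + \sum_(i < n.+1) e i = \sum_(i < n.+1) d i)%N ->
  weighted_sum E e = (orient E r)%:~R.
Proof.
elim: E r e => [|[a b] E IHE] r e bndE szr er sum_e.
  rewrite /orient; case: ifPn => [/hasP[i]|/hasPn r0].
    rewrite mem_iota add0n => /andP[_ ltir] lt_r; have ltin := leq_trans ltir szr.
    apply: weighted_sum_eq0 => //; exists (Ordinal ltin) => /=.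
    by move: (er i ltin) lt_r; rewrite /edge_count /=; lia.
  rewrite weighted_sum_nil big1 // => i _.
  rewrite mu_moment -er // ?leq_addr // -[X in X == _]addn0 eqn_add2l.
  have [szi|szi] := leqP (size r) i; first by rewrite nth_default.
  by have := r0 i; rewrite mem_iota szi -leqNgt leqn0 => /(_ isT)/eqP->.
rewrite /=; case: ifPn => [/hasP[i]|/hasPn r_le].
  rewrite mem_iota add0n => /andP[_ ltir] lt_r; have ltin := leq_trans ltir szr.
  apply: weighted_sum_eq0 => //; exists (Ordinal ltin) => /=.
  by move: (er i ltin) lt_r; lia.
case/andP: bndE => /andP[/= ltan ltbn] bndE.
have raise x : (x < n.+1)%N ->
    weighted_sum E (fun i => (i == x) + e i)%N =
    (if nth 0%N r x is k.+1 then orient E (set_nth 0%N r x k) else 0)%:~R.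
  move=> ltxn; have sumx: (size E + \sum_(i < n.+1) ((i == x :> nat) + e i) =
      \sum_(i < n.+1) d i)%N by rewrite sum_raise // addnS -addSn.
  case def_rx: (nth 0%N r x) => [|k].
    apply: weighted_sum_eq0 => //; exists (Ordinal ltxn) => /=.
    by rewrite eqxx -er // def_rx addn0 ltnSn.
  apply: IHE => //; first by rewrite size_set_nth geq_max ltxn.
  move=> i ltin; rewrite nth_set_nth /= -er //.
  by case: eqP => [->|_]; rewrite ?def_rx /=; lia.
by rewrite weighted_sum_cons // !raise // -mulrzBr.
Qed.

End Weighted.

(** Colors are numbered and seen as rationals. Expanding the product over [E] and
    applying the moment functionals, monomials of the right total degree with
    exponents other than [d] vanish, so the weighted sum is [orient E d]; a
    nonzero term of it is a coloring. *)
Theorem alon_tarsi (C : choiceType) (L : nat -> {fset C})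
    (E : seq (nat * nat)) (d : seq nat) :
  all (fun p => (p.1 < size d) && (p.2 < size d)) E -> size E = sumn d ->
  (forall i, nth 0 d i < #|` L i|) -> orient E d != 0%R ->
  exists phi : nat -> C, (forall i, i < size d -> phi i \in L i) /\
    {in E, forall p, phi p.1 <> phi p.2}.
Proof.
(* Working in ['I_n.+1] gives [inord] a meaning even for empty [d]; the extra vertex is isolated and
   has target exponent 0. *)
move=> bndE szE ltdL; pose n := size d.
pose A : seq C := undup (flatten [seq (L i : seq C) | i <- iota 0 n.+1]).
have LA (i : 'I_n.+1) c : c \in L i -> c \in A.
  by rewrite mem_undup => cLi; apply/flatten_mapP; exists (i : nat); rewrite ?mem_iota /=.
pose S (i : 'I_n.+1) := [set c : 'I_(size A) | tnth (in_tuple A) c \in L i].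
have card_S i : #|S i| = #|` L i|.
  rewrite -sum1_card; under eq_bigl do rewrite inE.
  rewrite -(big_tnth _ _ A (fun c => c \in L i) (fun=> 1)) sum1_count -size_filter.
  apply/perm_size/uniq_perm; rewrite ?filter_uniq ?undup_uniq ?fset_uniq // => c.
  by rewrite mem_filter andb_idr // => /LA.
have mu_ex (i : 'I_n.+1) := @moment_functional (size A) (nth 0 d i) (S i)
   (eq_ind_r (fun m => _ < m) (ltdL i) (card_S i)).
have [mu muP] := fin_all_exists mu_ex.
have bndE' : all (fun p => (p.1 < n.+1) && (p.2 < n.+1)) E.
  by apply: sub_all bndE => p /andP[lt1 lt2]; apply/andP; split; exact: leqW.
have mu_moment (i : 'I_n.+1) k : k <= nth 0 d i ->
    (\sum_c mu i c * c%:R ^+ k = (k == nth 0%N d i)%:R)%R.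
  exact: (muP i).2.
have := @weighted_sum_orient n _ _ mu mu_moment E d (fun=> 0) bndE' (leqnSn n)
  (fun i _ => add0n (nth 0 d i)).
rewrite big1 // addn0 big_ord_recr nth_default //= addn0 szE sumnE.
rewrite (big_nth 0) big_mkord => /(_ erefl) sumE.
rewrite -(intr_eq0 rat) -sumE => sumN0.
have [phi] : exists phi : {ffun 'I_n.+1 -> 'I_(size A)},
    ((\prod_i (mu i (phi i) * (phi i)%:R ^+ 0)) *
     \prod_(p <- E) ((phi (inord p.1))%:R - (phi (inord p.2))%:R) != 0)%R.
  apply/existsP; apply: contraNT sumN0 => /existsPn term0.
  by rewrite /weighted_sum big1 // => phi _; apply/eqP; rewrite -[_ == _]negbK.
rewrite mulf_eq0 negb_or => /andP[/prodf_neq0 muN0 EN0].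
 pose f (i : nat) := tnth (in_tuple A) (phi (inord i)).
exists f; split=> [i ltin|p Ep].
  have := muN0 (inord i) isT; rewrite mulf_eq0 => /norP[/(muP _).1 + _].
  by rewrite inE inordK // ltnW.
have /allP/(_ p Ep) := etrans (esym (prodf_seq_neq0 _ _ _)) EN0.
rewrite subr_eq0 eqr_nat /=; apply: contraNnot.
move/tuple_uniqP: (undup_uniq _ : uniq (in_tuple A)) => A_inj.
by move/A_inj->.
Qed.

(** A block of [n] vertices of degree 3 is encoded by a sequence [h] of length
    [3 * n]: entries [3 * k], [3 * k + 1], [3 * k + 2] are the indices of the
    heads of the arcs leaving vertex [k], the value [n] standing for a head
    outside the block. *)
Definition clash (h : seq nat) (p : nat * nat) : bool :=
  [|| p.1 %/ 3 == p.2 %/ 3, nth 0 h p.1 == p.2 %/ 3 | nth 0 h p.2 == p.1 %/ 3].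

Definition clashes (h : seq nat) : seq (nat * nat) :=
  [seq p <- [seq (i, j) | i <- iota 0 (size h), j <- iota 0 (size h)]
     | (p.1 < p.2) && clash h p].

(** Their reverses are the arcs that enter the tail of arc [i] from outside the block. *)
Definition exits (h : seq nat) (i : nat) : seq nat :=
  [seq k <- iota 0 (size h) | (k %/ 3 == i %/ 3) && (nth 0 h k == size h %/ 3)].

(** An arc loses at most one color to each arc entering its tail from outside
    and, if its head is outside, two more to the arcs leaving that head. *)
Definition certificate (h d : seq nat) : bool :=
  [&& size d == size h, size (clashes h) == sumn d,
      all (fun i => nth 0 d i + (size (exits h i) +
                     (nth 0 h i == size h %/ 3) * 2) <= 5) (iota 0 (size h))
    & orient (clashes h) d != 0%R].

(** ** Arcs *)

Section Arcs.
Variable G : multigraph.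
Implicit Types (i j k : incidence G) (u v w : vertex G) (S T : {set vertex G}).

(** The default is never taken, as every edge has a second end; likewise in [rev]. *)
Definition head i : vertex G :=
  odflt (inc_vertex i) [pick w in ends (inc_edge i) :\ inc_vertex i].

Definition rev i : incidence G := insubd i (head i, inc_edge i).

Lemma inc_inj i j : inc_vertex i = inc_vertex j -> inc_edge i = inc_edge j -> i = j.
Proof.
move=> eq_v eq_e; apply: val_inj; move: eq_v eq_e; rewrite /inc_vertex /inc_edge.
by case: (val i) (val j) => [? ?] [? ?] /= -> ->.
Qed.

Lemma inc_vertex_in i : inc_vertex i \in ends (inc_edge i).
Proof. exact: valP i. Qed.

Lemma ends_head i :
  head i != inc_vertex i /\ ends (inc_edge i) = [set inc_vertex i; head i].
Proof.
have /eqP := card_ends (inc_edge i).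
rewrite (cardsD1 (inc_vertex i)) inc_vertex_in => /cards1P[w def_w].
have -> : head i = w.
  rewrite /head; case: pickP => [x|/(_ w)]; rewrite def_w inE; first by move/eqP.
  by rewrite eqxx.
have : w \in ends (inc_edge i) :\ inc_vertex i by rewrite def_w inE.
by rewrite !inE => /andP[nw _]; rewrite -def_w setD1K // inc_vertex_in.
Qed.

Lemma head_neq i : (head i == inc_vertex i) = false.
Proof. by apply/negbTE; case: (ends_head i). Qed.

Lemma neq_head i : (inc_vertex i == head i) = false.
Proof. by rewrite eq_sym head_neq. Qed.

Lemma endsE i : ends (inc_edge i) = [set inc_vertex i; head i].
Proof. by case: (ends_head i). Qed.

Lemma val_rev i : val (rev i) = (head i, inc_edge i).
Proof. by rewrite val_insubd /= endsE !inE eqxx orbT. Qed.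

Lemma tail_rev i : inc_vertex (rev i) = head i.
Proof. by rewrite /inc_vertex val_rev. Qed.

Lemma edge_rev i : inc_edge (rev i) = inc_edge i.
Proof. by rewrite /inc_edge val_rev. Qed.

Lemma head_rev i : head (rev i) = inc_vertex i.
Proof.
have : head (rev i) \in ends (inc_edge (rev i)) by rewrite endsE !inE eqxx orbT.
by rewrite edge_rev endsE !inE -(tail_rev i) head_neq orbF => /eqP.
Qed.

Lemma revK : involutive rev.
Proof. by move=> i; apply: inc_inj; rewrite ?tail_rev ?head_rev ?edge_rev. Qed.

Lemma inc_adj_sym i j : inc_adj i j = inc_adj j i.
Proof.
rewrite /inc_adj eq_sym [inc_edge i == _]eq_sym [inc_vertex i == _]eq_sym.
by rewrite setUC [X in [|| _, _ | X]]orbC.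
Qed.

(** When the tails differ, sharing an edge or having an edge that joins the tails makes the head of
    one arc the tail of the other. *)
Lemma inc_adjP i j : inc_adj i j ->
  i != j /\ [|| inc_vertex i == inc_vertex j, head i == inc_vertex j
              | head j == inc_vertex i].
Proof.
case/andP=> nij adj; split=> //; apply/or3P.
have [->|nuv] := eqVneq (inc_vertex i) (inc_vertex j); first exact: Or31.
have mem_head k w : w \in ends (inc_edge k) -> inc_vertex k != w -> head k == w.
  by rewrite endsE !inE eq_sym => /orP[->//|]; rewrite eq_sym.
case/or4P: adj => [/eqP eq_uv|/eqP eq_e|/eqP def_e|/eqP def_f].
- by rewrite eq_uv eqxx in nuv.
- by apply: Or32; rewrite mem_head // eq_e inc_vertex_in.
- by apply: Or32; rewrite mem_head // def_e !inE eqxx orbT.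
- by apply: Or33; rewrite mem_head ?def_f ?inE ?eqxx // eq_sym.
Qed.

Definition arcs_from S : {set incidence G} := [set i | inc_vertex i \in S].

Lemma card_arcs_from v : #|arcs_from [set v]| = degree v.
Proof.
rewrite /degree -(card_in_imset (f := @inc_edge G)); last first.
  by move=> i j; rewrite !inE => /eqP <- /eqP/esym/inc_inj.
apply: eq_card => e; rewrite inE; apply/imsetP/idP => [[i + ->]|ve].
  by rewrite !inE => /eqP <-; apply: inc_vertex_in.
by exists (exist _ (v, e) ve) => //; rewrite !inE.
Qed.

Hypothesis subcubicG : subcubic G.

Lemma degree_le3 v : degree v <= 3.
Proof. exact: leq_trans (leq_bigmax v) subcubicG. Qed.

(** The factor is 2 rather than 3 because [rev i], which leaves the head of [i],
    is already counted among the arcs entering its tail. *)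
Lemma card_conflict S i : inc_vertex i \notin S ->
  #|[set j in arcs_from S | inc_adj j i]| <=
  #|[set k in arcs_from [set inc_vertex i] | head k \in S]| + (head i \in S) * 2.
Proof.
move=> Si; set A := [set k in arcs_from [set _] | _].
have [Shi|Shi] := boolP (head i \in S).
  apply: leq_trans (_ : #|rev @: A :|: (arcs_from [set head i] :\ rev i)| <= _).
    apply/subset_leq_card/subsetP => j; rewrite !inE => /andP[Sj /inc_adjP[_]].
    case/or3P => [/eqP tj|/eqP hj|/eqP hi].
    - by rewrite tj (negPf Si) in Sj.
    - by rewrite -[j]revK imset_f // !inE tail_rev hj eqxx head_rev.
    have [->|nj] := eqVneq j (rev i); last by rewrite hi eqxx orbT.
    by rewrite imset_f ?inE ?eqxx ?Shi.
  rewrite (leq_trans (leq_card_setU _ _)) // leq_add ?leq_imset_card //.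
  have := degree_le3 (head i); rewrite -card_arcs_from (cardsD1 (rev i)).
  by rewrite !inE tail_rev eqxx.
rewrite addn0 (leq_trans _ (leq_imset_card rev _)) //.
apply/subset_leq_card/subsetP => j; rewrite !inE => /andP[Sj /inc_adjP[_]].
case/or3P => [/eqP tj|/eqP hj|/eqP hi].
- by rewrite tj (negPf Si) in Sj.
- by rewrite -[j]revK imset_f // !inE tail_rev hj eqxx head_rev.
- by rewrite hi Sj in Shi.
Qed.

(** * Partial list colorings and greedy extension *)

Variables (C : choiceType) (L : incidence G -> {fset C}).
Hypothesis L6 : forall i, #|` L i| = 6.

Definition colorable (A : {set incidence G}) : Prop :=
  exists phi : incidence G -> C, {in A, forall i, phi i \in L i} /\
    {in A &, forall i j, inc_adj i j -> phi i <> phi j}.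

Definition residual (phi : incidence G -> C) (A : {set incidence G}) i : {fset C} :=
  (L i `\` [fset phi j | j in [set j in A | inc_adj j i]])%fset.

Lemma residualP phi A i c : c \in residual phi A i ->
  c \in L i /\ {in A, forall j, inc_adj j i -> phi j <> c}.
Proof.
rewrite inE => /andP[cN cL]; split=> // j Aj adj def_c; case/negP: cN.
by apply/imfsetP; exists j => //=; rewrite !inE Aj.
Qed.

Lemma card_residual phi A i :
  6 <= #|` residual phi A i| + #|[set j in A | inc_adj j i]|.
Proof.
rewrite cardfsD L6 addnC -leq_subLR leq_sub2l //.
rewrite (leq_trans (fsubset_leq_card (fsubsetIr _ _))) //.
by rewrite (leq_trans (leq_imfset_card _ _ _)) // cardE.
Qed.

Lemma colorable1 A i : colorable A -> #|[set j in A | inc_adj j i]| <= 5 ->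
  colorable (i |: A).
Proof.
move=> [phi [phiL phiP]] leN.
have [Ai|nAi] := boolP (i \in A).
  by exists phi; rewrite (setUidPr _) ?sub1set.
have /fset0Pn[c /residualP[cL cP]] : residual phi A i != fset0.
  by rewrite -cardfs_gt0; have := card_residual phi A i; lia.
have out j : j \in A -> (j == i) = false.
  by move=> Aj; apply: contraNF nAi => /eqP <-.
exists (fun j => if j == i then c else phi j); split.
  move=> j /setU1P[->|Aj]; first by rewrite eqxx.
  by rewrite out // phiL.
move=> j k /setU1P[->|Aj] /setU1P[->|Ak] adj.
- by case/andP: adj; rewrite eqxx.
- by rewrite eqxx out // => /esym; apply: cP; rewrite // inc_adj_sym.
- by rewrite eqxx out //; apply: cP.
- by rewrite !out //; apply: phiP.
Qed.

(** The arcs of [B] are colored in any order: at most [#|B| - 1] of them precede a given one, so it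
    meets at most 5 forbidden colors out of 6. *)
Lemma colorable_greedy A (B : {set incidence G}) : colorable A ->
  {in B, forall i, #|[set j in A | inc_adj j i]| + #|B| <= 6} ->
  colorable (A :|: B).
Proof.
have [m] := ubnP #|B|; elim: m A B => // m IHm A B; rewrite ltnS => leBm colA leN.
have [->|[i Bi]] := set_0Vmem B; first by rewrite setU0.
have := cardsD1 i B; rewrite Bi add1n => cardB.
have -> : A :|: B = (i |: A) :|: (B :\ i).
  by rewrite -{1}(setD1K Bi) setUCA setUA.
apply: IHm => [||j]; first by rewrite -ltnS -cardB.
  by apply: colorable1 => //; have := leN i Bi; lia.
rewrite !inE => /andP[_ Bj]; have := leN j Bj; rewrite cardB.
suff : #|[set k in i |: A | inc_adj k j]| <= #|[set k in A | inc_adj k j]|.+1 by lia.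
rewrite -[leqRHS]add1n -[X in X + _](cards1 i).
apply: leq_trans (leq_card_setU _ _); apply/subset_leq_card/subsetP => k.
by rewrite !inE => /andP[/orP[->//|->] ->]; rewrite orbT.
Qed.

(** The [b <= 2] arcs from [v] into [S] come first: each has at most [b + 2] conflicts in [S] and
    [b - 1] with its own kind, at most 5 in all. Each remaining arc has at most [b] conflicts in [S]
    and 2 at [v]. *)
Lemma colorable_vertex S v : v \notin S -> colorable (arcs_from S) ->
  #|[set k in arcs_from [set v] | head k \in S]| <= 2 ->
  colorable (arcs_from (S :|: [set v])).
Proof.
move=> Sv colS; set B := [set k in arcs_from [set v] | _] => leB2.
pose D := [set k in arcs_from [set v] | head k \notin S].
have cardBD : #|B| + #|D| <= 3.
  rewrite (leq_trans _ (degree_le3 v)) // -card_arcs_from.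
  rewrite -(cardsID [set k | head k \in S] (arcs_from [set v])).
  by rewrite leq_add // subset_leq_card //; apply/subsetP => k; rewrite !inE => /andP[-> ->].
have -> : arcs_from (S :|: [set v]) = (arcs_from S :|: B) :|: D.
  apply/setP => k; rewrite !inE -orbA; congr (_ || _).
  by rewrite -andb_orr orbN andbT.
have colSB : colorable (arcs_from S :|: B).
  apply: colorable_greedy => // i; rewrite !inE => /andP[/eqP ti hi].
  have := @card_conflict S i; rewrite ti hi -/B => /(_ Sv); lia.
apply: colorable_greedy => // i; rewrite !inE => /andP[/eqP ti hi].
have := @card_conflict S i; rewrite ti (negPf hi) -/B => /(_ Sv).
suff : #|[set j in arcs_from S :|: B | inc_adj j i]| <=
       #|[set j in arcs_from S | inc_adj j i]| + #|B| by lia.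
apply: leq_trans (leq_card_setU _ _); apply/subset_leq_card/subsetP => j.
by rewrite !inE => /andP[/orP[->|/andP[-> ->]] ->]; rewrite ?orbT.
Qed.

(** * Absorbable sets and certificates *)

Definition absorbable T : Prop := forall S, [disjoint S & T] ->
  colorable (arcs_from S) -> colorable (arcs_from (S :|: T)).

(** Given a coloring of the arcs leaving [S], the conflict graph of the block is colored from the
    residual lists, which [certificate] makes large enough for [alon_tarsi]. A vertex outside [vs]
    has index [size vs], the code for outside in [h]. *)
Lemma absorbable_certificate (i0 : incidence G) (h d : seq nat)
    (vs : seq (vertex G)) (s : seq (incidence G)) :
  certificate h d -> size h = size vs * 3 ->
  [seq index (inc_vertex i) vs | i <- s] = [seq m %/ 3 | m <- iota 0 (size h)] ->
  [seq index (head i) vs | i <- s] = h ->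
  (forall i, inc_vertex i \in vs -> i \in s) ->
  absorbable [set v in vs].
Proof.
case/and4P=> /eqP szd /eqP szE /allP capd AT szh tails heads cover S dis.
case=> phi [phiL phiP].
have szvs : size vs = size h %/ 3 by rewrite szh mulnK.
have szs : size s = size h by rewrite -heads size_map.
have tailE (k : nat) : k < size s -> index (inc_vertex (nth i0 s k)) vs = k %/ 3.
  move=> ltk; rewrite -(nth_map i0 0 (fun i => index (inc_vertex i) vs)) // tails.
  by rewrite (nth_map 0) ?size_iota -?szs // nth_iota // -szs.
have headE (k : nat) : k < size s -> index (head (nth i0 s k)) vs = nth 0 h k.
  by move=> ltk; rewrite -(nth_map i0 0 (fun i => index (head i) vs)) // heads.
have notin v : v \in S -> v \notin vs.
  by move=> Sv; have := disjointFr dis Sv; rewrite inE => ->.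
have tail_s (k : nat) : k < size s -> inc_vertex (nth i0 s k) \in vs.
  by move=> ltk; rewrite -index_mem tailE // ltn_divLR // -szh -szs.
(* [alon_tarsi] bounds the list at every index, so indices past the block receive some nonempty
   list. *)
pose L' (k : nat) := if k < size s then residual phi (arcs_from S) (nth i0 s k) else L i0.
have ltdL (k : nat) : nth 0 d k < #|` L' k|.
  rewrite /L'; case: ifPn => [ltk|]; last first.
    by rewrite -leqNgt szs -szd => leq; rewrite nth_default // L6.
  have := card_residual phi (arcs_from S) (nth i0 s k).
  have := capd k; rewrite mem_iota add0n -szs => /(_ ltk).
  have nSk : inc_vertex (nth i0 s k) \notin S.
    by apply: contraL (tail_s k ltk) => /notin.
  have := card_conflict nSk.
  have hS v : v \in S -> index v vs = size h %/ 3.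
    by move=> /notin/memNindex; rewrite szvs.
  have le_out : (head (nth i0 s k) \in S) <= (nth 0 h k == size h %/ 3).
    by rewrite -headE //; case: (boolP (_ \in S)) => // /hS ->; rewrite eqxx.
  (* A vertex of [S] is outside the block, so the arcs from this tail into [S] are among its
     exits. *)
  have : #|[set i in arcs_from [set inc_vertex (nth i0 s k)] | head i \in S]|
      <= size (exits h k); last by lia.
  rewrite -(size_map (nth i0 s)) cardE uniq_leq_size ?enum_uniq // => i.
  rewrite mem_enum !inE => /andP[/eqP ti hi].
  have si : i \in s by rewrite cover // ti tail_s.
  have lti : index i s < size s by rewrite index_mem.
  apply/mapP; exists (index i s); last by rewrite nth_index.
  rewrite mem_filter mem_iota add0n -szs lti -tailE // -headE // nth_index //.
  by rewrite ti tailE // hS // szs !eqxx.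
have bndE : all (fun p => (p.1 < size d) && (p.2 < size d)) (clashes h).
  apply/allP => p; rewrite mem_filter => /andP[_ /allpairsP[[a b] /= [ha hb ->]]] /=.
  by rewrite szd; move: ha hb; rewrite !mem_iota !add0n => /andP[_ ->] /andP[_ ->].
have [chi [chiL chiP]] := alon_tarsi bndE szE ltdL AT.
have chi_adj i j : i \in s -> j \in s -> inc_adj i j ->
    chi (index i s) <> chi (index j s).
  move=> si sj; wlog lt : i j si sj / index i s < index j s => [IH adj|].
    case: (ltngtP (index i s) (index j s)) => [lt|lt|eq]; first exact: IH.
      by move/esym; apply: IH; rewrite // inc_adj_sym.
    by case/andP: adj; rewrite -(nth_index i0 si) eq nth_index // eqxx.
  case/inc_adjP=> _ adj; apply: (chiP (index i s, index j s)).
  rewrite mem_filter /= lt allpairs_f ?mem_iota ?add0n -?szs ?index_mem // andbT.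
  rewrite /clash /= -!tailE -?headE ?index_mem // !nth_index //.
  by case/or3P: adj => /eqP->; rewrite eqxx ?orbT.
exists (fun i => if inc_vertex i \in S then phi i else chi (index i s)).
have in_s i : i \in arcs_from (S :|: [set v in vs]) -> inc_vertex i \notin S -> i \in s.
  by rewrite !inE => /orP[->//|ti _]; apply: cover.
have res i : i \in s -> chi (index i s) \in residual phi (arcs_from S) i.
  move=> si; have := chiL (index i s); rewrite szd -szs index_mem /L' => /(_ si).
  by rewrite index_mem si nth_index.
split=> [i Ai|i j Ai Aj adj].
  case: ifPn => [Si|Si]; first by rewrite phiL // inE.
  by have [] := residualP (res i (in_s i Ai Si)).
case: ifPn => Si; case: ifPn => Sj.
- by apply: phiP; rewrite ?inE.
- by have [_] := residualP (res j (in_s j Aj Sj)); apply; rewrite ?inE.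
- have [_ /(_ j)] := residualP (res i (in_s i Ai Si)).
  by rewrite inE inc_adj_sym => /(_ Sj adj) + /esym.
- by apply: chi_adj => //; apply: in_s.
Qed.

(** ** Absorbable blocks in a 3-regular part *)

Section Reducible.
Local Arguments index : simpl never.
Variable P : pred (vertex G).
Hypothesis cubicP : forall v, P v -> degree v = 3.
Hypothesis closedP : forall i, P (inc_vertex i) -> P (head i).

Lemma out_arcs i : P (inc_vertex i) -> exists j k,
  [/\ uniq [:: i; j; k], inc_vertex j = inc_vertex i, inc_vertex k = inc_vertex i
    & forall l, inc_vertex l = inc_vertex i -> l \in [:: i; j; k]].
Proof.
move=> /cubicP/eqP; rewrite -card_arcs_from (cardsD1 i) !inE eqxx.
case/cards2P=> j [k [njk def_jk]]; exists j, k.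
have mem l : (l != i) && (inc_vertex l == inc_vertex i) = (l == j) || (l == k).
  by have /setP/(_ l) := def_jk; rewrite !inE.
have := mem j; have := mem k; rewrite !eqxx orbT /=.
case/andP=> nki /eqP tk /andP[nji /eqP tj]; split=> //.
  by rewrite /= !inE !negb_or ![i == _]eq_sym nji nki njk.
by move=> l tl; have := mem l; rewrite tl eqxx andbT !inE => <-; case: eqP.
Qed.

Lemma out_arcs2 i j : P (inc_vertex i) -> i != j -> inc_vertex i = inc_vertex j ->
  exists k, [/\ uniq [:: i; j; k], inc_vertex k = inc_vertex i
    & forall l, inc_vertex l = inc_vertex i -> l \in [:: i; j; k]].
Proof.
move=> Pi nij tij; have [k [l [ukl tk tl mem]]] := out_arcs Pi.
have := mem j (esym tij); rewrite !inE eq_sym (negPf nij) /= => /orP[]/eqP ej.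
  by exists l; rewrite ej.
exists k; rewrite ej; split=> // [|m /mem]; last by rewrite !inE [(m == l) || _]orbC.
by move: ukl; rewrite /= !inE andbC orbC [k == l]eq_sym andbC.
Qed.

Definition reducible_block : Prop :=
  exists vs, [/\ vs != [::], all P vs & absorbable [set v in vs]].

(** In a triple edge the six arcs conflict pairwise, and outdegrees 0 to 5 in prescribed places are
    realized only by one transitive orientation. Otherwise the third arcs at both ends leave the
    block. *)
Lemma reducible_parallel i j : P (inc_vertex i) -> i != j ->
  inc_vertex i = inc_vertex j -> head i = head j -> reducible_block.
Proof.
move=> Pi nij tij hij; set v := inc_vertex i; set w := head i.
have [k [uk tk outv]] := out_arcs2 Pi nij tij.
have [l [ul tl outw]] : exists l, [/\ uniq [:: rev i; rev j; l], inc_vertex l = w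
    & forall m, inc_vertex m = w -> m \in [:: rev i; rev j; l]].
  rewrite /w -tail_rev; apply: out_arcs2; rewrite ?tail_rev // ?closedP //.
  by rewrite (inj_eq (inv_inj revK)).
have nvw : v != w by rewrite neq_head.
have uvs : uniq [:: v; w] by rewrite /= inE nvw.
have iv : index v [:: v; w] = 0 := @index_uniq _ v 0 [:: v; w] isT uvs.
have iw : index w [:: v; w] = 1 := @index_uniq _ v 1 [:: v; w] isT uvs.
have cover : forall m, inc_vertex m \in [:: v; w] -> m \in [:: i; j; k; rev i; rev j; l].
  move=> m; rewrite !inE => /orP[/eqP/outv|/eqP/outw]; rewrite !inE.
    by case/or3P=> ->; rewrite ?orbT.
  by case/or3P=> ->; rewrite ?orbT.
exists [:: v; w]; split; rewrite //= ?Pi ?closedP //.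
set vs := [:: v; w] in iv iw cover uvs *.
have [hk|nhk] := eqVneq (head k) w.
  (* The block is the whole component, a triple edge. *)
  apply: (absorbable_certificate (h := [:: 1; 1; 1; 0; 0; 0])
    (d := [:: 5; 1; 0; 2; 3; 4]) i _ _ _ _ cover); first by vm_compute.
  - by [].
  - by rewrite /= !tail_rev -tij -hij tk tl -/v -/w iv iw.
  have : rev k \in [:: rev i; rev j; l] by rewrite outw // tail_rev.
  rewrite !inE !(inj_eq (inv_inj revK)) /=.
  move: uk; rewrite /= !inE negb_or andbT => /andP[/andP[_ nik] njk].
  rewrite ![k == _]eq_sym (negPf nik) (negPf njk) /= => /eqP <-.
  by rewrite /= !head_rev -tij -hij hk tk -/v -/w iv iw.
apply: (absorbable_certificate (h := [:: 1; 1; 2; 0; 0; 2])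
    (d := [:: 1; 4; 2; 2; 3; 2]) i _ _ _ _ cover); first by vm_compute.
- by [].
- by rewrite /= !tail_rev -tij -hij tk tl -/v -/w iv iw.
have hk : head k \notin vs by rewrite !inE negb_or nhk -[v]tk head_neq.
have hl : head l \notin vs.
  (* If [l] ended at [v], its reverse would have to be [k], and [k] would end at [w]. *)
  rewrite !inE negb_or -[w]tl head_neq andbT; apply/eqP => hlv.
  have : rev l \in [:: i; j; k] by rewrite outv // tail_rev.
  rewrite !inE -![rev l == _](inj_eq (inv_inj revK)) revK.
  move: ul; rewrite /= !inE negb_or andbT => /andP[/andP[_ nil] njl].
  rewrite ![l == _]eq_sym (negPf nil) (negPf njl) /= => /eqP/(congr1 rev).
  by rewrite revK => def_k; rewrite def_k head_rev tl eqxx in nhk.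
by rewrite /= !head_rev -tij -hij -/v -/w iv iw !memNindex.
Qed.

(** Each configuration is excluded once treated, which makes the next ones induced. *)
Hypothesis simpleP : forall i j, P (inc_vertex i) ->
  inc_vertex i = inc_vertex j -> head i = head j -> i = j.

Lemma third_arc v x y i j : P v -> inc_vertex i = v -> inc_vertex j = v ->
  head i = x -> head j = y -> x != y ->
  exists k, [/\ inc_vertex k = v, [/\ head k != v, head k != x & head k != y]
    & forall l, inc_vertex l = v -> l \in [:: i; j; k]].
Proof.
move=> Pv ti tj hi hj nxy; have nij : i != j.
  by apply: contra_neq nxy => eij; rewrite -hi -hj eij.
have [||k [uk tk outv]] := @out_arcs2 i j _ nij; rewrite ?ti ?tj //.
exists k; rewrite ti in tk outv; split=> //; rewrite -tk head_neq.
move: uk; rewrite /= !inE negb_or andbT => /andP[/andP[_ nik] njk].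
split=> //.
  by apply: contra_neq nik => hk; apply: simpleP; rewrite ?ti ?tk ?hi.
by apply: contra_neq njk => hk; apply: simpleP; rewrite ?tj ?tk ?hj.
Qed.

(** The third arc at each corner leaves the block. The sum of [d] is the number of conflicts, 3 at
    each vertex and 5 across each edge: 24 here, 32 for the square and 35 for the fork. *)
Lemma reducible_triangle a b c i j k : P a -> inc_vertex i = a ->
  inc_vertex j = b -> inc_vertex k = c -> head i = b -> head j = c -> head k = a ->
  reducible_block.
Proof.
move=> Pa ti tj tk hi hj hk.
have Pb : P b by rewrite -hi closedP ?ti.
have Pc : P c by rewrite -hj closedP ?tj.
have nab : a != b by rewrite -ti -hi neq_head.
have nbc : b != c by rewrite -tj -hj neq_head.
have nca : c != a by rewrite -tk -hk neq_head.
have [||x [tx [xa xb xc] outa]] := @third_arc a b c i (rev k) Pa ti _ hi _ nbc;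
  rewrite ?tail_rev ?head_rev //.
have [||y [ty [yb yc ya] outb]] := @third_arc b c a j (rev i) Pb tj _ hj _ nca;
  rewrite ?tail_rev ?head_rev //.
have [||z [tz [zc za zb] outc]] := @third_arc c a b k (rev j) Pc tk _ hk _ nab;
  rewrite ?tail_rev ?head_rev //.
exists [:: a; b; c]; split; rewrite //= ?Pa ?Pb ?Pc //.
have uvs : uniq [:: a; b; c] by rewrite /= !inE negb_or nab nbc eq_sym nca.
have ia := @index_uniq _ a 0 [:: a; b; c] isT uvs.
have ib := @index_uniq _ a 1 [:: a; b; c] isT uvs.
have ic := @index_uniq _ a 2 [:: a; b; c] isT uvs.
rewrite /= in ia ib ic.
apply: (absorbable_certificate (h := [:: 1; 2; 3; 2; 0; 3; 0; 1; 3])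
  (d := [:: 4; 4; 0; 3; 4; 0; 4; 4; 1])
  (s := [:: i; rev k; x] ++ [:: j; rev i; y] ++ [:: k; rev j; z]) i).
- by vm_compute.
- by [].
- by rewrite /= !tail_rev hi hj hk ti tj tk tx ty tz ia ib ic.
- rewrite /= !head_rev hi hj hk ti tj tk ia ib ic.
  by rewrite !memNindex // !inE !negb_or ?xa ?xb ?ya ?yb ?za ?zb.
move=> l vl; have : [|| inc_vertex l == a, inc_vertex l == b | inc_vertex l == c].
  by move: vl; rewrite !inE.
by rewrite !mem_cat => /or3P[]/eqP => [/outa|/outb|/outc] ->; rewrite ?orbT.
Qed.

Hypothesis no_triangle : forall i j k, P (inc_vertex i) ->
  head i = inc_vertex j -> head j = inc_vertex k -> head k <> inc_vertex i.

Lemma reducible_square a b c d i j k l : P a -> a != c -> b != d ->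
  inc_vertex i = a -> inc_vertex j = b -> inc_vertex k = c -> inc_vertex l = d ->
  head i = b -> head j = c -> head k = d -> head l = a -> reducible_block.
Proof.
move=> Pa nac nbd ti tj tk tl hi hj hk hl.
have Pb : P b by rewrite -hi closedP ?ti.
have Pc : P c by rewrite -hj closedP ?tj.
have Pd : P d by rewrite -hk closedP ?tk.
have nab : a != b by rewrite -ti -hi neq_head.
have nbc : b != c by rewrite -tj -hj neq_head.
have ncd : c != d by rewrite -tk -hk neq_head.
have nda : d != a by rewrite -tl -hl neq_head.
(* A diagonal would close a triangle with two sides of the square. *)
have chord u v w e f x : P u -> inc_vertex e = u -> head e = v ->
    inc_vertex f = v -> head f = w -> inc_vertex x = u -> head x != w.
  move=> Pu te he tf hf tx; apply/eqP => hx.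
  by apply: (@no_triangle e f (rev x)); rewrite ?te ?tail_rev ?head_rev ?he ?hf ?tx.
have [||x [tx [xa xb xd] outa]] := @third_arc a b d i (rev l) Pa ti _ hi _ nbd;
  rewrite ?tail_rev ?head_rev //.
have xc : head x != c by apply: (chord a b c i j).
have [|||y [ty [yb yc ya] outb]] := @third_arc b c a j (rev i) Pb tj _ hj _ _;
  rewrite ?tail_rev ?head_rev // 1?eq_sym //.
have yd : head y != d by apply: (chord b c d j k).
have [|||z [tz [zc zd zb] outc]] := @third_arc c d b k (rev j) Pc tk _ hk _ _;
  rewrite ?tail_rev ?head_rev // 1?eq_sym //.
have za : head z != a by apply: (chord c d a k l).
have [||t [tt [td ta tc] outd]] := @third_arc d a c l (rev k) Pd tl _ hl _ nac;
  rewrite ?tail_rev ?head_rev //.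
have tb : head t != b by apply: (chord d a b l i).
exists [:: a; b; c; d]; split; rewrite //= ?Pa ?Pb ?Pc ?Pd //.
have uvs : uniq [:: a; b; c; d].
  by rewrite /= !inE !negb_or nab nac nbc nbd ncd eq_sym nda.
have ia := @index_uniq _ a 0 [:: a; b; c; d] isT uvs.
have ib := @index_uniq _ a 1 [:: a; b; c; d] isT uvs.
have ic := @index_uniq _ a 2 [:: a; b; c; d] isT uvs.
have id := @index_uniq _ a 3 [:: a; b; c; d] isT uvs.
rewrite /= in ia ib ic id.
apply: (absorbable_certificate (h := [:: 1; 3; 4; 2; 0; 4; 3; 1; 4; 0; 2; 4])
  (d := [:: 4; 3; 0; 4; 3; 0; 3; 4; 1; 4; 4; 2])
  (s := [:: i; rev l; x] ++ [:: j; rev i; y] ++ [:: k; rev j; z] ++ [:: l; rev k; t]) i).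
- by vm_compute.
- by [].
- by rewrite /= !tail_rev hi hj hk hl ti tj tk tl tx ty tz tt ia ib ic id.
- rewrite /= !head_rev hi hj hk hl ti tj tk tl ia ib ic id.
  by rewrite !memNindex // !inE !negb_or ?xa ?xb ?xc ?ya ?yb ?yc ?za ?zb ?zc ?ta ?tb ?tc.
move=> m vm; have : [|| inc_vertex m == a, inc_vertex m == b, inc_vertex m == c
  | inc_vertex m == d] by move: vm; rewrite !inE.
by rewrite !mem_cat => /or4P[]/eqP => [/outa|/outb|/outc|/outd] ->; rewrite ?orbT.
Qed.

Hypothesis no_square : forall i j k l, P (inc_vertex i) ->
  inc_vertex i != inc_vertex k -> inc_vertex j != inc_vertex l ->
  head i = inc_vertex j -> head j = inc_vertex k -> head k = inc_vertex l ->
  head l <> inc_vertex i.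

Lemma out_heads v x i : P v -> inc_vertex i = v -> head i = x ->
  exists j k, [/\ inc_vertex j = v, inc_vertex k = v,
    [/\ head j != v, head k != v, head j != x, head k != x & head j != head k]
    & forall l, inc_vertex l = v -> l \in [:: i; j; k]].
Proof.
move=> Pv ti hi; have [|j [k [uijk tj tk outv]]] := @out_arcs i; rewrite ?ti //.
rewrite ti in tj tk outv; exists j, k; split=> //.
rewrite -{1}tj -{1}tk !head_neq.
move: uijk; rewrite /= !inE negb_or andbT => /andP[/andP[nij nik] njk].
by split=> //; [move: nij | move: nik | move: njk]; apply: contra_neq => eq_h;
  apply: simpleP; rewrite ?ti ?tj ?tk ?hi.
Qed.

(** The claw at [v] has leaves [head i2], [head i3] and [head m], with [head i1] subdividing the
    edge towards [head m]. Any chord would close a triangle or a 4-cycle. *)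
Lemma reducible_fork v : P v -> reducible_block.
Proof.
move=> Pv.
have [i1 ti1] : exists i, inc_vertex i = v.
  have : 0 < #|arcs_from [set v]| by rewrite card_arcs_from cubicP.
  by case/card_gt0P=> i; rewrite !inE => /eqP; exists i.
have [i2 [i3 [ti2 ti3 [nbv ncv nba nca nbc] outv]]] := out_heads Pv ti1 erefl.
(* [tri] and [quad] turn the excluded triangles and 4-cycles through [v] into non-adjacencies in the
   block. *)
have tri e x g : inc_vertex e = v -> inc_vertex g = v -> inc_vertex x = head e ->
    head x != head g.
  move=> te tg tx; apply/eqP => hx; apply: (@no_triangle e x (rev g)).
  - by rewrite te.
  - by rewrite tx.
  - by rewrite tail_rev hx.
  - by rewrite head_rev te tg.
have quad e x z g : inc_vertex e = v -> inc_vertex g = v -> inc_vertex x = head e ->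
    inc_vertex z = head x -> head x != v -> head e != head g -> head z != head g.
  move=> te tg tx tz nxv neg; apply/eqP => hz.
  apply: (@no_square e x z (rev g)); rewrite ?tail_rev ?head_rev ?te ?tx ?tz //.
  by rewrite eq_sym.
have Pa : P (head i1) by rewrite closedP ?ti1.
have Pb : P (head i2) by rewrite closedP ?ti2.
have Pc : P (head i3) by rewrite closedP ?ti3.
have [||m [y [tm ty [nwa nya nwv nyv nwy] outa]]] := @out_heads (head i1) v (rev i1) Pa;
  rewrite ?tail_rev ?head_rev ?ti1 //.
have Pw : P (head m) by rewrite closedP ?tm.
have [||b1 [b2 [tb1 tb2 [nb1b nb2b nb1v nb2v _] outb]]] :=
  @out_heads (head i2) v (rev i2) Pb; rewrite ?tail_rev ?head_rev ?ti2 //.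
have [||c1 [c2 [tc1 tc2 [nc1c nc2c nc1v nc2v _] outc]]] :=
  @out_heads (head i3) v (rev i3) Pc; rewrite ?tail_rev ?head_rev ?ti3 //.
have [||w1 [w2 [tw1 tw2 [nw1w nw2w nw1a nw2a _] outw]]] :=
  @out_heads (head m) (head i1) (rev m) Pw; rewrite ?tail_rev ?head_rev ?tm //.
pose vs := [:: v; head i1; head i2; head i3; head m].
have side e x : inc_vertex e = v -> head e != head i1 -> inc_vertex x = head e ->
    head x != v -> head x \notin vs.
  move=> te nea tx nxv; rewrite !inE !negb_or nxv.
  rewrite (tri e x i1) // (tri e x i2) // (tri e x i3) //=.
  apply/eqP => hx; have := @quad e x (rev m) i1 te ti1 tx.
  by rewrite tail_rev head_rev hx tm eqxx => /(_ erefl nwv nea).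
have yvs : head y \notin vs.
  by rewrite !inE !negb_or nyv nya (tri i1 y i2) // (tri i1 y i3) // eq_sym.
have wvs x : inc_vertex x = head m -> head x != head i1 -> head x \notin vs.
  move=> tx nxa; rewrite !inE !negb_or nxa -[head m in X in _ && X]tx head_neq.
  rewrite !(quad i1 m x) ?andbT //=; try by rewrite eq_sym.
  by apply/eqP => hx; apply: (@no_triangle i1 m x); rewrite ?ti1.
have uvs : uniq vs.
  rewrite /= !inE !negb_or -{1}ti1 -{1}ti2 -{1}ti3 !neq_head.
  rewrite [v == _]eq_sym nwv ![head i1 == _]eq_sym nba nca nwa nbc.
  by rewrite ![_ == head m]eq_sym (tri i1 m i2) // (tri i1 m i3).
exists vs; split; rewrite //= ?Pv ?Pa ?Pb ?Pc ?Pw //.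
have iv := @index_uniq _ v 0 vs isT uvs.
have ia := @index_uniq _ v 1 vs isT uvs.
have ib := @index_uniq _ v 2 vs isT uvs.
have ic := @index_uniq _ v 3 vs isT uvs.
have iw := @index_uniq _ v 4 vs isT uvs.
rewrite /= in iv ia ib ic iw.
(* An arc leaving the block at a leaf is sure of only 2 colors: 2 may be lost to arcs entering its
   tail and 2 to arcs leaving its head. Hence [d] is at most 1 there. *)
apply: (absorbable_certificate
  (h := [:: 1; 2; 3; 0; 4; 5; 0; 5; 5; 0; 5; 5; 1; 5; 5])
  (d := [:: 5; 5; 4; 4; 4; 1; 3; 0; 1; 3; 0; 1; 3; 1; 0])
  (s := [:: i1; i2; i3] ++ [:: rev i1; m; y] ++ [:: rev i2; b1; b2]
        ++ [:: rev i3; c1; c2] ++ [:: rev m; w1; w2]) i1).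
- by vm_compute.
- by [].
- rewrite /= !tail_rev ti1 ti2 ti3 tm ty tb1 tb2 tc1 tc2 tw1 tw2.
  by rewrite iv ia ib ic iw.
- rewrite /= !head_rev ti1 ti2 ti3 tm iv ia ib ic iw.
  rewrite (memNindex yvs) (memNindex (side i2 b1 ti2 nba tb1 nb1v)).
  rewrite (memNindex (side i2 b2 ti2 nba tb2 nb2v)).
  rewrite (memNindex (side i3 c1 ti3 nca tc1 nc1v)).
  rewrite (memNindex (side i3 c2 ti3 nca tc2 nc2v)).
  by rewrite (memNindex (wvs w1 tw1 nw1a)) (memNindex (wvs w2 tw2 nw2a)).
move=> l vl.
have : [|| inc_vertex l == v, inc_vertex l == head i1, inc_vertex l == head i2,
   inc_vertex l == head i3 | inc_vertex l == head m] by move: vl; rewrite !inE.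
rewrite !mem_cat => /or4P[| | |/orP[]] /eqP => [/outv|/outa|/outb|/outc|/outw] ->;
  by rewrite ?orbT.
Qed.

End Reducible.

(** The configurations are sought in turn, the absence of each giving the hypothesis for the next;
    without the first three, a fork exists at any vertex. *)
Lemma reducible_cubic (P : pred (vertex G)) v : P v ->
  (forall u, P u -> degree u = 3) ->
  (forall i, P (inc_vertex i) -> P (head i)) -> reducible_block P.
Proof.
move=> Pv cubicP closedP.
have [[i [j [Pi nij tij hij]]]|simple] := pselect (exists i j,
  [/\ P (inc_vertex i), i != j, inc_vertex i = inc_vertex j & head i = head j]).
  exact: (reducible_parallel cubicP closedP Pi nij tij hij).
have simpleP i j : P (inc_vertex i) -> inc_vertex i = inc_vertex j ->
    head i = head j -> i = j.
  move=> Pi tij hij; apply/eqP/contraT => nij.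
  by case: simple; exists i, j.
have [[i [j [k [Pi hi hj hk]]]]|no_tri] := pselect (exists i j k,
  [/\ P (inc_vertex i), head i = inc_vertex j, head j = inc_vertex k
     & head k = inc_vertex i]).
  exact: (reducible_triangle cubicP closedP simpleP Pi erefl erefl erefl hi hj hk).
have no_triangle i j k : P (inc_vertex i) ->
    head i = inc_vertex j -> head j = inc_vertex k -> head k <> inc_vertex i.
  by move=> Pi hi hj hk; case: no_tri; exists i, j, k.
have [[i [j [k [l [Pi [nik njl] hi [hj hk hl]]]]]]|no_sq] :=
  pselect (exists i j k l, [/\ P (inc_vertex i),
    inc_vertex i != inc_vertex k /\ inc_vertex j != inc_vertex l,
    head i = inc_vertex j & [/\ head j = inc_vertex k, head k = inc_vertex l
     & head l = inc_vertex i]]).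
  exact: (reducible_square cubicP closedP simpleP no_triangle Pi nik njl
    erefl erefl erefl erefl hi hj hk hl).
apply: (reducible_fork cubicP closedP simpleP no_triangle _ Pv).
by move=> i j k l Pi nik njl hi hj hk hl; case: no_sq; exists i, j, k, l.
Qed.

(** * Absorbing all vertices *)

Lemma absorbableU T (U : {set vertex G}) : [disjoint T & U] ->
  absorbable T -> absorbable U -> absorbable (T :|: U).
Proof.
rewrite disjoint_sym disjoints_subset => disUT absT absU S.
rewrite disjoints_subset setCU subsetI => /andP[disT disU] colS.
(* [U] is absorbed first, then [T] over [S :|: U]. *)
rewrite setUCA setUC; apply: absT; first by rewrite disjoints_subset subUset disT disUT.
by apply: absU; rewrite // disjoints_subset.
Qed.

Lemma absorbable_grow T : absorbable T -> T != [set: vertex G] ->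
  exists2 U, absorbable U & T \proper U.
Proof.
move=> absT; rewrite -subTset => /subsetPn[v0 _ Tv0].
have [[v [Tv low]]|stuck] := pselect (exists v, v \notin T /\
  (degree v <= 2 \/ exists2 i, inc_vertex i = v & head i \in T)).
  exists (T :|: [set v]); last first.
    by rewrite setUC properUr // sub1set.
  move=> S; rewrite disjoints_subset setCU subsetI.
  rewrite [S \subset ~: [set v]]subsetC sub1set inE.
  case/andP=> disT Sv colS; rewrite setUCA setUC; apply: absT.
    by rewrite disjoints_subset subUset disT sub1set inE Tv.
  (* [v] is colored before [T], so an arc from [v] into [T] does not count as an arc into [S]; at
     most 2 arcs into [S] remain. *)
  apply: colorable_vertex => //; case: low => [|[i ti hi]].
    apply: leq_trans; rewrite -card_arcs_from subset_leq_card //.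
    by apply/subsetP => k; rewrite !inE => /andP[].
  rewrite -ltnS (leq_trans _ (degree_le3 v)) // -card_arcs_from proper_card //.
  apply/properP; split; first by apply/subsetP => k; rewrite !inE => /andP[].
  exists i; rewrite !inE ti eqxx //=; apply: contraL hi => /(subsetP disT).
  by rewrite inE.
(* Being stuck means that the complement of [T] is 3-regular and closed under following arcs. *)
have [|i Ti|vs [vs0 /allP Pvs absvs]] := @reducible_cubic (fun v => v \notin T) v0 Tv0.
- move=> u Tu; apply/eqP; rewrite eqn_leq degree_le3 ltnNge /=.
  by apply/negP => low; apply: stuck; exists u; split=> //; left.
- apply/negP => hi; apply: stuck; exists (inc_vertex i); split=> //.
  by right; exists i.
exists (T :|: [set v in vs]).
  apply: absorbableU => //; rewrite disjoint_subset; apply/subsetP => u Tu.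
  by rewrite !inE; apply: contraL Tu => /Pvs.
apply/properP; split; first exact: subsetUl.
case: vs vs0 Pvs absvs => // u vs _ Pvs _.
by exists u; rewrite ?Pvs ?inE ?eqxx ?orbT.
Qed.

Lemma colorable_all : colorable [set: incidence G].
Proof.
have absT : absorbable [set: vertex G].
  have abs0 : absorbable set0 by move=> S _; rewrite setU0.
  (* Induction on the number of vertices not yet absorbed. *)
  move: {2}_.+1 (ltnSn #|~: (set0 : {set vertex G})|) abs0 => m.
  elim: m (set0 : {set vertex G}) => // m IHm T leTm absT.
  have [<- //|nT] := eqVneq T setT.
  have [U absU TU] := absorbable_grow absT nT; apply: IHm absU.
  by rewrite -ltnS (leq_trans _ leTm) // ltnS proper_card // properC.
have [|| phi colphi] := absT set0; first by rewrite disjoints_subset sub0set.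
  (* The empty coloring is still a function into [C]: a constant is taken from some list, and if
     there is no arc [C] may be empty. *)
  have [[i]|no_arc] := pselect (exists i : incidence G, True); last first.
    exists (fun i => False_rect _ (no_arc (ex_intro _ i I))).
    by split=> i; rewrite !inE.
  have /fset0Pn[c _] : L i != fset0 by rewrite -cardfs_gt0 L6.
  by exists (fun=> c); split=> k; rewrite !inE.
have -> : [set: incidence G] = arcs_from (set0 :|: [set: vertex G]).
  by apply/setP => i; rewrite !inE.
by exists phi.
Qed.

End Arcs.

Theorem theorem1p3 (G : multigraph) (hG : subcubic G) : ch_i G <= 6.
Proof.
rewrite /ch_i; case: ex_minnP => n _; apply; rewrite /choosable_pred /=.
apply/asboolP => C L [_ L6].
have [phi [phiL phiP]] := colorable_all hG L6.
by exists phi; split=> [i j|i]; [apply: phiP | apply: phiL].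
Qed.
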